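(* Let $\mathbb{T}=\mathbb{R}^+$ or $\mathbb{T}=\mathbb{R}$, let $m\ge 1$, and let $\Sigma=(\Omega,\mathcal{F},P,(\theta_t)_{t\in\mathbb{T}})$ be the canonical dynamical system of the standard $\mathbb{R}^m$-valued Brownian motion with time set $\mathbb{T}$. Let $\tau>0$. Then $\Sigma$ is ergodic, and the discrete dynamical system $\Sigma^\tau=(\Omega,\mathcal{F},P,(\theta_\tau^n)_{n\ge 0})$ is ergodic.
   Context: A standard Brownian motion $(W_t)_{t\in\mathbb{T}}$ in $\mathbb{R}^m$ is a process with $W_0=0$ and stationary independent increments satisfying $W_t-W_s\sim\mathcal{N}(0,|t-s|I)$. The canonical (Wiener) space is $\Omega=\mathcal{C}_0(\mathbb{T},\mathbb{R}^m)$, the continuous functions $\omega:\mathbb{T}\to\mathbb{R}^m$ with $\omega(0)=0$ (with the topology of uniform convergence on compact sets), $\mathcal{F}$ is its Borel $\sigma$-algebra, $P$ is Wiener measure (the law of Brownian motion), and $W_t(\omega)=\omega(t)$. The Brownian shift is $(\theta_t\omega)(s)=\omega(t+s)-\omega(t)$ for $s,t\in\mathbb{T}$; each $\theta_t$ preserves $P$. A measure preserving dynamical system is ergodic if every invariant set has measure $0$ or $1$: for $\Sigma$, every $A\in\mathcal{F}$ with $\theta_t^{-1}A=A$ for all $t\in\mathbb{T}$; for $\Sigma^\tau$, every $A\in\mathcal{F}$ with $\theta_\tau^{-1}A=A$. *)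

(* Defs.v *)
From HB Require Import structures.
From mathcomp Require Import all_boot all_order all_algebra.
From mathcomp Require Import all_classical all_reals all_analysis.

Set Implicit Arguments.
Unset Strict Implicit.
Unset Printing Implicit Defensive.

Import Order.TTheory GRing.Theory Num.Theory numFieldNormedType.Exports.
Local Open Scope classical_set_scope.
Local Open Scope ring_scope.

Section Generic.
Context d (X : measurableType d) (R : realType) (P : probability X R).

Definition measure_preserving (f : X -> X) : Prop :=
  measurable_fun setT f /\
  forall A, measurable A -> P (f @^-1` A) = P A.

Definition ergodic_family (I : Type) (theta : I -> X -> X) : Prop :=
  (forall t, measure_preserving (theta t)) /\
  forall A, measurable A -> (forall t, theta t @^-1` A = A) ->
    P A = 0%E \/ P A = 1%E.

(* Invariance under all iterates of [f] is the same as invariance under [f]. *)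
Definition ergodic_map (f : X -> X) : Prop :=
  measure_preserving f /\
  forall A, measurable A -> f @^-1` A = A -> P A = 0%E \/ P A = 1%E.

(* Subfamilies are covered by taking [B i = setT] for the other indices. *)
Definition mutually_independent d' (E : measurableType d') n
    (Y : 'I_n -> X -> E) : Prop :=
  forall B : 'I_n -> set E, (forall i, measurable (B i)) ->
    P [set x | forall i, B i (Y i x)] = (\prod_(i < n) P (Y i @^-1` B i))%E.

End Generic.

Section Vectors.
Context (R : realType).

(* The library's [normal_prob 0 0] is not the point mass at [0] (it is the
   uniform law on [0, 1]), hence the case of null variance. *)
Definition centered_normal (v : R) : set R -> \bar R :=
  if v == 0 then \d_(0 : R) else normal_prob 0 (Num.sqrt v).

Definition borel_rV (m : nat) := g_sigma_algebraType (@open 'rV[R]_m).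

(* The law of [Y] is N(0, v I), i.e. the product of [m] copies of N(0, v); it
   is determined by its values on the measurable rectangles. *)
Definition isotropic_normal d (X : measurableType d) (P : probability X R)
    m (Y : X -> 'rV[R]_m) (v : R) : Prop :=
  forall A : 'I_m -> set R, (forall i, measurable (A i)) ->
    P [set x | forall i, A i (Y x ord0 i)] =
    (\prod_(i < m) centered_normal v (A i))%E.

End Vectors.

Variant time_axis := HalfLine | FullLine.

Section Time.
Context (R : realType) (T : time_axis).

Definition time_set : set R :=
  match T with
  | HalfLine => [set t | 0 <= t]
  | FullLine => [set: R]
  end.

Definition time : Type := set_type time_set.
HB.instance Definition _ := Topological.copy time (set_type time_set).

Lemma time0_subproof : (0 : R) \in time_set.
Proof. by rewrite inE /time_set; case: T => /=. Qed.

Definition time0 : time := exist _ 0 time0_subproof.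

Lemma timeD_subproof (s t : time) : val s + val t \in time_set.
Proof.
case: s t => [s /= +] [t /= +]; rewrite !inE /time_set.
by case: T => //=; exact: addr_ge0.
Qed.

Definition timeD (s t : time) : time :=
  exist _ (val s + val t) (timeD_subproof s t).

Lemma timeD_continuous (t : time) : continuous (timeD t).
Proof.
move=> s; apply/continuous_comp_initial => {}s.
apply: (@continuous_comp _ _ _ (val : time -> R) (fun r : R => val t + r)).
  exact: initial_continuous.
by move=> r; apply: cvgD; [exact: cvg_cst | exact: cvg_id].
Qed.

End Time.

Section BrownianMotion.
Context (R : realType) (T : time_axis) (m : nat).
Local Notation TT := (time R T).

Record brownian_motion d (X : measurableType d) (P : probability X R)
    (W : TT -> X -> 'rV[R]_m) : Prop := BrownianMotion {
  bm_measurable : forall t, measurable_fun setT (W t : X -> borel_rV R m) ;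
  bm_start : forall x, W (time0 R T) x = 0 ;
  bm_stationary : forall (s t h : TT) (B : set (borel_rV R m)), measurable B ->
    P [set x | B (W (timeD h t) x - W (timeD h s) x)] =
    P [set x | B (W t x - W s x)] ;
  bm_independent : forall (n : nat) (t : nat -> TT),
    (forall i, val (t i) <= val (t i.+1)) ->
    mutually_independent P
      (fun (i : 'I_n) x => (W (t i.+1) x - W (t i) x : borel_rV R m)) ;
  bm_normal : forall s t : TT,
    isotropic_normal P (fun x => W t x - W s x) `|val t - val s|
}.

(* [{family compact, _ -> _}] is the topology of uniform convergence on compact
   sets; [paths] inherits it as a subspace. *)
Definition path_set : set {family compact, TT -> 'rV[R]_m} :=
  [set w | continuous (w : TT -> 'rV[R]_m) /\ w (time0 R T) = 0].

Definition paths : Type := set_type path_set.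
HB.instance Definition _ := Topological.copy paths (set_type path_set).

Definition path_fun (w : paths) : TT -> 'rV[R]_m := val w.

Lemma path0_subproof :
  ((fun=> 0) : {family compact, TT -> 'rV[R]_m}) \in path_set.
Proof. by rewrite inE; split=> //; exact: cst_continuous. Qed.

Definition path0 : paths := exist _ (fun=> 0) path0_subproof.
HB.instance Definition _ := isPointed.Build paths path0.

Definition wiener_space := g_sigma_algebraType (@open paths).
HB.instance Definition _ := Measurable.on wiener_space.

Definition coordinate (t : TT) (w : wiener_space) : 'rV[R]_m := path_fun w t.

(* Wiener measure is the law under which the coordinate process is a standard
   Brownian motion. *)
Definition wiener_measure (P : probability wiener_space R) : Prop :=
  brownian_motion P coordinate.

Definition brownian_shift_fun (t : TT) (w : paths) :
    {family compact, TT -> 'rV[R]_m} :=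
  fun s => path_fun w (timeD t s) - path_fun w t.

Lemma brownian_shift_subproof (t : TT) (w : paths) :
  brownian_shift_fun t w \in path_set.
Proof.
have [cw w0] : path_set (val w) by apply/set_mem; exact: (valP w).
rewrite inE; split; last first.
  rewrite /brownian_shift_fun (_ : timeD t (time0 R T) = t) ?subrr//.
  by apply/val_inj; rewrite /= addr0.
move=> s; apply: (@continuousB _ _ _ (fun s => path_fun w (timeD t s))
  (fun=> path_fun w t)); last exact: cst_continuous.
by apply: continuous_comp; [exact: timeD_continuous | exact: cw].
Qed.

Definition brownian_shift (t : TT) (w : wiener_space) : wiener_space :=
  exist _ (brownian_shift_fun t w) (brownian_shift_subproof t w).

End BrownianMotion.

(* Main.v *)
Require Import Defs.
From HB Require Import structures.
From mathcomp Require Import all_boot all_order all_algebra.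
From mathcomp Require Import finmap.
From mathcomp Require Import all_classical all_reals all_analysis.
From mathcomp Require Import measurable_realfun.
From mathcomp Require Import lra.

(** Increments over disjoint time intervals are independent, so an event
    depending on finitely many times is independent of its own preimage under a
    sufficiently long shift.  These events form an algebra, which generates the
    Borel sigma-algebra because every open set of paths is a countable union of
    countable intersections of cylinders; hence every event [A] is within [e]
    of such an event [B] in probability.  If [A] is invariant,
    [P A = P (A `&` theta^-n A)] is within [2 e] of
    [P (B `&` theta^-n B) = P B ^+ 2] for a suitable [n], so
    [P A = P A ^+ 2]. *)

Set Implicit Arguments.
Unset Strict Implicit.
Unset Printing Implicit Defensive.

Import Order.TTheory GRing.Theory Num.Theory numFieldNormedType.Exports.
Local Open Scope classical_set_scope.
Local Open Scope ring_scope.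

(** * Approximation by an algebra and a zero-one law *)

Section MeasureTheory.
Context d (X : measurableType d) (R : realType) (P : probability X R).
Implicit Types (A B C : set X) (G : set (set X)).

Lemma measurable_preimage (f : X -> X) A :
  measurable_fun setT f -> measurable A -> measurable (f @^-1` A).
Proof. by move=> mf mA; rewrite -[_ @^-1` _]setTI; exact: mf. Qed.

(** Uniqueness of finite measures on a pi-system, applied to [P] and its pushforward under [f];
    [G setT] supplies the exhausting sequence. *)
Lemma eq_probability_sigma (f : X -> X) G : measurable_fun setT f ->
  setI_closed G -> G setT -> G `<=` measurable ->
  (forall A, G A -> P (f @^-1` A) = P A) ->
  forall A, <<s G >> A -> P (f @^-1` A) = P A.
Proof.
move=> mf GI GT Gm PG A sA.
have := @g_sigma_algebra_measure_unique _ _ _ G Gm (fun=> setT) (fun=> GT) _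
  (pushforward P f) P GI PG _ A sA; apply.
- by rewrite bigcup_const.
- by move=> _; rewrite /= /pushforward preimage_setT probability_setT ltry.
Unshelve. all: exact: mf.
Qed.

(** For fixed [C] both sides are finite measures in [A]: the pushforward of [P] restricted to [C],
    and the pushforward of [P] scaled by [P C]. Agreement on the pi-system [G] therefore extends to
    [<<s G >>]. *)
Lemma independent_sigma (f : X -> X) C G : measurable_fun setT f ->
  measurable C -> setI_closed G -> G setT -> G `<=` measurable ->
  (forall A, G A -> P (C `&` f @^-1` A) = (P C * P (f @^-1` A))%E) ->
  forall A, <<s G >> A -> P (C `&` f @^-1` A) = (P C * P (f @^-1` A))%E.
Proof.
move=> mf mC GI GT Gm PG A sA.
pose r : {nonneg R} := NngNum (fine_ge0 (measure_ge0 P C)).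
have rE : (r%:num%:E = P C)%E by rewrite /= fineK// fin_num_measure.
rewrite setIC -rE.
have := @g_sigma_algebra_measure_unique _ _ _ G Gm (fun=> setT) (fun=> GT) _
  (pushforward (mrestr P mC) f) (mscale r (pushforward P f)) GI _ _ A sA.
apply.
- by rewrite bigcup_const.
- by move=> B GB; rewrite /= /pushforward /mrestr /mscale rE setIC; exact: PG.
- by move=> _; rewrite /= /pushforward /mrestr preimage_setT setTI
    (le_lt_trans (probability_le1 _ _))// ltry.
Unshelve. all: exact: mf.
Qed.


Lemma measurableY A B : measurable A -> measurable B -> measurable (A `+` B).
Proof. by move=> mA mB; apply: measurableU; exact: measurableD. Qed.

Lemma probability_sub_setU A B C : measurable A -> measurable B ->
  measurable C -> A `<=` B `|` C -> (P A <= P B + P C)%E.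
Proof.
move=> mA mB mC ABC; apply: (le_trans _ (measureU2 P mB mC)).
by apply: le_measure; rewrite ?inE//; exact: measurableU.
Qed.

(** The measurable sets that can be so approximated form a lambda-system containing the pi-system
    [G], hence contain [<<s G >>]. *)
Lemma algebra_approx G : G setT -> setI_closed G -> setC_closed G ->
  G `<=` measurable -> measurable `<=` <<s G >> ->
  forall A, measurable A -> forall e : R, 0 < e ->
  exists2 B, G B & (P (A `+` B) < e%:E)%E.
Proof.
move=> GT GI GC Gm mG A mA.
pose L := [set A | measurable A /\
  forall e : R, 0 < e -> exists2 B, G B & (P (A `+` B) < e%:E)%E].
suff : <<s G >> `<=` L by move=> /(_ _ (mG _ mA))[].
apply: lambda_system_subset => //; last first.
  move=> B GB; split; first exact: Gm.
  by move=> e e0; exists B; rewrite // setYK measure0 lte_fin.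
split => //.
- by split => // e e0; exists setT; rewrite // setYK measure0 lte_fin.
- move=> B C CB [mB hB] [mC hC]; split; first exact: measurableD.
  move=> e e0; have e20 : 0 < e / 2 by rewrite divr_gt0.
  have [B' GB' B'e] := hB _ e20; have [C' GC' C'e] := hC _ e20.
  exists (B' `&` ~` C'); first by apply: GI => //; exact: GC.
  apply: (@le_lt_trans _ _ (P (B `+` B') + P (C `+` C'))%E); last first.
    by rewrite [e in ltRHS]splitr EFinD lteD.
  have mB' := Gm _ GB'; have mC' := Gm _ GC'.
  apply: probability_sub_setU; rewrite -?setDE;
    try by (do ?[exact: measurableY|apply: measurableY|exact: measurableD]).
  by move=> x /=; move: (EM (B x)) (EM (C x)) (EM (B' x)) (EM (C' x)); tauto.
- move=> F ndF hF; have mF n : measurable (F n) by have [] := hF n.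
  have mU : measurable (\bigcup_n F n) by exact: bigcupT_measurable.
  split => // e e0; have e20 : 0 < e / 2 by rewrite divr_gt0.
  have mD n : measurable (\bigcup_n F n `\` F n) by exact: measurableD.
  (* The remainders decrease to the empty set, so by continuity from above some [F n] fills the
     union up to [e / 2]; an [e / 2]-approximation of this [F n] then serves for the union. *)
  have : P (\bigcup_n F n `\` F n) @[n --> \oo] -->
      P (\bigcap_n (\bigcup_n F n `\` F n)).
    apply: nonincreasing_cvg_mu => //.
    - by rewrite (le_lt_trans (probability_le1 _ _))// ltry.
    - exact: bigcapT_measurable.
    - by move=> m n mn; apply/subsetPset; apply: setDS; exact/subsetPset/ndF.
  rewrite (_ : \bigcap_n _ = set0); last first.
    by apply/seteqP; split => // x /= h; have [[n _ Fx]] := h 0 I;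
      have [] := h n I.
  rewrite measure0 => /(_ [set u | (u < (e / 2)%:E)%E])[].
    by apply: open_ereal_lt'; rewrite lte_fin.
  move=> n _ /(_ n (leqnn n)) /= hn.
  have [B GB Be] := (hF n).2 _ e20; exists B => //.
  have mB := Gm _ GB.
  apply: (@le_lt_trans _ _ (P (\bigcup_n F n `\` F n) + P (F n `+` B))%E).
    apply: probability_sub_setU => //; do ?exact: measurableY.
    move=> x [[[k _ Fkx] nBx]|[Bx nUx]].
      by have [Fnx|nFnx] := pselect (F n x); [right; left|left; split => //;
        exists k].
    by right; right; split => // Fnx; apply: nUx; exists n.
  by rewrite [e in ltRHS]splitr EFinD lteD.
Qed.

Lemma setY_setI A A' B B' :
  (A `&` B) `+` (A' `&` B') `<=` (A `+` A') `|` (B `+` B').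
Proof.
by move=> x /=; move: (EM (A x)) (EM (A' x)) (EM (B x)) (EM (B' x)); tauto.
Qed.

Lemma fine_probability_dist A B : measurable A -> measurable B ->
  `|fine (P A) - fine (P B)| <= fine (P (A `+` B)).
Proof.
move=> mA mB; have mAB := measurableY mA mB.
have h C D : measurable C -> measurable D ->
    fine (P C) <= fine (P D) + fine (P (C `+` D)).
  move=> mC mD; have mCD := measurableY mC mD.
  rewrite -fineD ?fin_num_measure// fine_le ?fin_numD ?fin_num_measure//.
  by apply: probability_sub_setU => // x /=; move: (EM (C x)) (EM (D x)); tauto.
have := h _ _ mA mB; have := h _ _ mB mA; rewrite setYC.
by rewrite ler_norml; lra.
Qed.

Lemma zero_one_of_asymptotic_independence (f : nat -> X -> X) G :
  (forall n, measure_preserving P (f n)) ->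
  G setT -> setI_closed G -> setC_closed G ->
  G `<=` measurable -> measurable `<=` <<s G >> ->
  (forall A, G A ->
    exists n, P (A `&` f n @^-1` A) = (P A * P (f n @^-1` A))%E) ->
  forall A, measurable A -> (forall n, f n @^-1` A = A) ->
  P A = 0%E \/ P A = 1%E.
Proof.
move=> fP GT GI GC Gm mG indep A mA fA.
pose p B := fine (P B).
(* The constant 4 is 2 + 2: [p A] is within [2 * e] of [p B ^+ 2], which is within [2 * e] of
   [p A ^+ 2] because [p A] and [p B] lie in [0, 1] at distance at most [e]. *)
suff hp : forall e, 0 < e -> `|p A - p A ^+ 2| <= 4 * e.
  have : p A * (1 - p A) = 0.
    apply/eqP; rewrite mulrBr mulr1 -expr2 -normr_eq0 eq_le normr_ge0 andbT.
    apply/ler_addgt0Pl => e e0; rewrite addr0.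
    have /hp : 0 < e / 4 by rewrite divr_gt0.
    by rewrite mulrCA divff ?mulr1.
  have PE : P A = (p A)%:E by rewrite fineK// fin_num_measure.
  by move=> /eqP; rewrite mulf_eq0 subr_eq0 PE => /orP[]/eqP; [left|right];
    congr EFin.
move=> e e0; have [B GB ABe] := algebra_approx GT GI GC Gm mG mA e0.
have mB := Gm _ GB; have [n nB] := indep _ GB; have [mf Pf] := fP n.
have mfB := measurable_preimage mf mB.
have eY : p (A `+` B) < e.
  by rewrite -lte_fin fineK// fin_num_measure//; exact: measurableY.
have AB : `|p A - p B| <= e.
  exact: (le_trans (fine_probability_dist mA mB) (ltW eY)).
have AB2 : `|p A - p B ^+ 2| <= 2 * e.
  have -> : p B ^+ 2 = p (B `&` f n @^-1` B).
    by rewrite /p nB Pf// fineM ?fin_num_measure.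
  (* Invariance writes [A] as the intersection with its own preimage. The symmetric difference with
     [B] and its preimage costs [e] twice, since [f n] preserves [P]. *)
  rewrite -{1}[A]setIid -{2}(fA n).
  have mfA : measurable (f n @^-1` A) by rewrite fA.
  have [m1 m2] : measurable (A `&` f n @^-1` A) /\
    measurable (B `&` f n @^-1` B) by split; exact: measurableI.
  apply: (le_trans (fine_probability_dist m1 m2)).
  have fY : f n @^-1` A `+` f n @^-1` B = f n @^-1` (A `+` B) by [].
  have := probability_sub_setU (measurableY m1 m2) (measurableY mA mB)
    (measurableY mfA mfB) (@setY_setI _ _ _ _).
  rewrite fY Pf; last exact: measurableY.
  have fY1 : P (A `+` B) \is a fin_num.
    by rewrite fin_num_measure//; exact: measurableY.
  move=> /fine_le; rewrite fin_numD fY1 fineD// => h.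
  have /h : P ((A `&` f n @^-1` A) `+` (B `&` f n @^-1` B)) \is a fin_num.
    by rewrite fin_num_measure//; exact: measurableY.
  move=> /(_ isT) {}h; apply: (le_trans h); rewrite mulr_natl mulr2n.
  by rewrite lerD// ltW.
have [B0 B1] : 0 <= p B /\ p B <= 1.
  split; first exact: fine_ge0.
  by rewrite -lee_fin fineK ?fin_num_measure// probability_le1.
have [A0 A1] : 0 <= p A /\ p A <= 1.
  split; first exact: fine_ge0.
  by rewrite -lee_fin fineK ?fin_num_measure// probability_le1.
move: AB AB2; rewrite !ler_norml !expr2 => /andP[? ?] /andP[? ?].
by apply/andP; split; nra.
Qed.

End MeasureTheory.

(** * The topology of compact convergence *)

Definition rat_real (R : realType) (q : rat) : R := ratr q.

Lemma rat_between (R : realType) (x y : R) :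
  x < y -> exists q : rat, x < rat_real R q < y.
Proof. by move=> /rat_in_itvoo[q]; rewrite in_itv; exists q. Qed.

(* [compact_cover] is only available for pointed spaces. *)
HB.instance Definition _ (R : realType) (T : time_axis) :=
  isPointed.Build (time R T) (time0 R T).

(** * Density of the rational times *)

Section Time.
Context (R : realType) (T : time_axis).
Local Notation TT := (time R T).

Lemma nbhs_timeP (t : TT) (S : set TT) : nbhs t S ->
  exists2 e : R, 0 < e & forall s : TT, `|\val t - \val s| < e -> S s.
Proof.
move=> [_ [[V oV <-] /= Vt] VS].
have /nbhs_ballP[e /= e0 tV] : nbhs (\val t) V by exact: open_nbhs_nbhs.
by exists e => // s ts; apply: VS; exact: tV.
Qed.

(** A rational outside the time set is sent to time 0, so that all of [rat] can serve as a countable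
    index. *)
Definition rat_time (q : rat) : TT := insubd (time0 R T) (rat_real R q).

Lemma rat_time_dense (t : TT) (S : set TT) :
  nbhs t S -> exists q, S (rat_time q).
Proof.
move=> /nbhs_timeP[e e0 tS].
(* The rational is taken to the right of [t], which keeps it nonnegative on the half line. *)
have /rat_between[q] : \val t < \val t + e by rewrite ltrDl.
move=> /andP[tq qe]; exists q; apply: tS.
rewrite /rat_time val_insubd.
have -> : rat_real R q \in @time_set R T.
  have := valP t; rewrite !inE /time_set; case: T t tq qe => //= t tq _ t0.
  exact: (le_trans t0 (ltW tq)).
by rewrite distrC ger0_norm ?subr_ge0 ?ltrBlDl ?(ltW tq).
Qed.

End Time.

(** * A countable description of the open sets of paths *)

Section Paths.
Context (R : realType) (T : time_axis) (m : nat).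
Local Notation TT := (time R T).
Local Notation paths := (paths R T m).
Local Notation wiener := (wiener_space R T m).

Lemma path_continuous (w : paths) : continuous (path_fun w).
Proof. by have [] : path_set (val w) by apply/set_mem; exact: (valP w). Qed.

Lemma path_time0 (w : paths) : path_fun w (time0 R T) = 0.
Proof. by have [] : path_set (val w) by apply/set_mem; exact: (valP w). Qed.

Lemma path_entry_continuous (w : paths) (i : 'I_m) :
  continuous (fun t => path_fun w t ord0 i).
Proof.
move=> t; apply: (@continuous_comp _ _ _ (path_fun w) (fun v => v ord0 i)).
  exact: path_continuous.
exact: coord_continuous.
Qed.

(** Compact convergence implies pointwise convergence, and [paths] carries the induced topology. *)
Lemma path_eval_continuous (t : TT) :
  continuous (fun w : paths => path_fun w t).
Proof.
move=> w.
pose f : {family compact, TT -> 'rV[R]_m} := val w.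
have h : nbhs f --> f by [].
have h2 := (pointwise_cvgP _ _).1 (pointwise_cvg_compact_family _ h) t.
have h3 : continuous (val : paths -> {family compact, TT -> 'rV[R]_m}).
  exact: initial_continuous.
by move=> S /h2; exact: h3.
Qed.

(* The cell [(a, b, v, e)] stands for the paths that stay in the closed box of
   radius [e] around [v] during the time window ]a, b[. *)
Definition cell := (rat * rat * 'rV[rat]_m * rat)%type.

Definition cell_window (c : cell) : set TT :=
  [set t | rat_real R c.1.1.1 < \val t < rat_real R c.1.1.2].

Definition in_box (c : cell) (v : 'rV[R]_m) : Prop :=
  forall i, `|rat_real R (c.1.2 ord0 i) - v ord0 i| <= rat_real R c.2.

(* Only rational times are tested, so that [fits cs] is a countable
   intersection of cylinders. *)
Definition fits (cs : seq cell) : set paths :=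
  [set w | forall c, c \in cs -> forall q, cell_window c (rat_time R T q) ->
    in_box c (path_fun w (rat_time R T q))].

Lemma cell_window_open c : open (cell_window c).
Proof.
exists `](rat_real R c.1.1.1), (rat_real R c.1.1.2)[%classic.
  exact: interval_open.
by apply/seteqP; split => t; rewrite /= in_itv.
Qed.

(** Passage from rational times to all times: the box is closed and the window open, so a path
    outside the box at [t] would still be outside at some rational time of the window. *)
Lemma fits_window cs w c t : fits cs w -> c \in cs -> cell_window c t ->
  in_box c (path_fun w t).
Proof.
move=> ws cc ct i; rewrite leNgt; apply/negP => out.
have nS : nbhs t (cell_window c `&`
    [set s | rat_real R c.2 <
      `|rat_real R (c.1.2 ord0 i) - path_fun w s ord0 i|]).
  apply: filterI.
    by apply: open_nbhs_nbhs; split => //; exact: cell_window_open.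
  have : continuous (fun s =>
      `|rat_real R (c.1.2 ord0 i) - path_fun w s ord0 i|).
    move=> s; apply: (@continuous_comp _ _ _
        (fun s => rat_real R (c.1.2 ord0 i) - path_fun w s ord0 i) Num.norm).
      apply: (@continuousB _ R^o _ (fun=> rat_real R (c.1.2 ord0 i))).
        exact: cst_continuous.
      exact: path_entry_continuous.
    exact: norm_continuous.
  by move=> /(_ t)/cvgr_gt; apply.
have [q [cq /=]] := rat_time_dense nS.
by rewrite ltNge (ws c cc q cq i).
Qed.

Lemma fits_cat cs cs' : fits (cs ++ cs') = fits cs `&` fits cs'.
Proof.
apply/seteqP; split => [w h|w [h h'] c].
  by split => c cc; apply: h; rewrite mem_cat cc ?orbT.
by rewrite mem_cat => /orP[/h|/h'].
Qed.

(** Near [t] the path moves by less than [e / 2], and the rational center of the box is within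
    [e / 2] of the value at [t]. *)
Lemma path_local_cell (w : paths) (t : TT) (e : rat) : 0 < rat_real R e ->
  exists c, [/\ c.2 = e, cell_window c t & fits [:: c] w].
Proof.
move=> e0; have e20 : 0 < rat_real R e / 2 by rewrite divr_gt0.
have /nbhs_timeP[r r0 hr] : nbhs t
    [set s | ball (path_fun w t) (rat_real R e / 2) (path_fun w s)].
  by apply: (@path_continuous w t); exact: nbhsx_ballx.
have /rat_between[a /andP[ra at_]] : \val t - r < \val t.
  by rewrite ltrBlDl ltrDr.
have /rat_between[b /andP[tb br]] : \val t < \val t + r by rewrite ltrDl.
have hv i : exists q : rat, path_fun w t ord0 i < rat_real R q <
    path_fun w t ord0 i + rat_real R e / 2.
  by apply: rat_between; rewrite ltrDl.
pose v : 'rV[rat]_m := \row_i projT1 (cid (hv i)).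
exists (a, b, v, e); split => //=; first by rewrite /cell_window /= at_ tb.
move=> c; rewrite inE => /eqP -> q.
rewrite /cell_window /= => /andP[aq qb] i /=.
have tq : `|\val t - \val (rat_time R T q)| < r.
  by move: ra at_ tb br; rewrite ltr_norml /=; lra.
have [_ /(_ ord0 i)] := hr _ tq.
rewrite /ball /= mxE; case: cid => /= x /andP[].
by rewrite ltr_norml ler_norml; lra.
Qed.

(* Convergence of this filter to [w] says that the sets [fits cs] containing [w]
   are a neighborhood base at [w]. *)
Definition fit_filter (w : paths) :
    set_system {family compact, TT -> 'rV[R]_m} :=
  [set S | exists2 cs, fits cs w & forall w', fits cs w' -> S (val w')].

Lemma fit_filter_filter w : Filter (fit_filter w).
Proof.
split.
- by exists [::].
- move=> S S' [cs wcs h] [cs' wcs' h'].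
  exists (cs ++ cs'); first by rewrite fits_cat.
  by move=> w'; rewrite fits_cat => -[/h ? /h' ?].
- by move=> S S' SS' [cs wcs h]; exists cs => // w' /h /SS'.
Qed.

(** Finitely many windows of cells of radius [q < e / 2] fitted by [w] cover the compact set [A]; a
    path fitting the same cells is within [2 * q < e] of [w] on [A]. *)
Lemma fit_filter_cvg (w : paths) : {family compact, fit_filter w --> val w}.
Proof.
have FF := fit_filter_filter w.
apply/fam_cvgP => A cA S /uniform_nbhs[E [entE ES]].
move: entE; rewrite -entourage_ballE => -[e /= e0 eE].
have /rat_between[q /andP[q0 qe]] : 0 < e / 2 by rewrite divr_gt0.
move: cA; rewrite compact_cover.
move=> /(_ cell [set c | c.2 = q /\ fits [:: c] w] cell_window)[].
- by move=> c _; exact: cell_window_open.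
- move=> t At; have [c [cq ct cw]] := path_local_cell w t q0.
  by exists c.
move=> D hD Acov; exists (enum_fset D).
  move=> c cD; have /set_mem[_ /(_ c)] := hD _ cD.
  by apply; rewrite mem_head.
move=> w' w'D; apply: ES => t At; apply: eE => /=.
have [c cD ct] := Acov _ At.
have /set_mem[cq cw] := hD _ cD.
have h1 := fits_window cw (mem_head _ _) ct.
have h2 := fits_window w'D cD ct.
split => // i j; rewrite ord1 /ball /=.
have := h1 j; have := h2 j; rewrite cq !ler_norml ltr_norml /path_fun; lra.
Qed.

(** Lists of cells form a countable type, so this union is countable. *)
Lemma open_paths_fits (U : set paths) : open U ->
  U = \bigcup_(cs in [set cs | fits cs `<=` U]) fits cs.
Proof.
move=> [V oV <-]; apply/seteqP; split => [w Vw|w [cs /= csU]]; last exact: csU.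
have : fit_filter w V.
  by apply: (@fit_filter_cvg w); apply: open_nbhs_nbhs.
by move=> [cs wcs h]; exists cs.
Qed.

End Paths.

(** * Cylinders and increments *)

Lemma countable_bigcapT_measurable d (X : measurableType d) (U : countType)
    (F : U -> set X) :
  (forall i, measurable (F i)) -> measurable (\bigcap_i F i).
Proof.
move=> mF; rewrite -[X in measurable X]setCK setC_bigcap.
apply: measurableC; apply: countable_bigcupT_measurable.
  exact: countableP.
by move=> i; exact: measurableC.
Qed.

Lemma measurable_implies d (X : measurableType d) (Q : Prop) (A : set X) :
  measurable A -> measurable [set x | Q -> A x].
Proof.
move=> mA; have [q|nq] := pselect Q.
  rewrite (_ : [set x | _] = A)//.
  by apply/seteqP; split=> x /=; [exact|].
rewrite (_ : [set x | _] = setT)//.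
by apply/seteqP; split=> x //= _ /nq.
Qed.

Section Cylinders.
Context (R : realType) (T : time_axis) (m : nat).
Local Notation TT := (time R T).
Local Notation wiener := (wiener_space R T m).

Lemma measurable_entry (i : 'I_m) :
  measurable_fun setT (fun v : borel_rV R m => v ord0 i).
Proof.
apply: (measurability _ (RGenOpens.measurableE R)).
move=> _ [_ [x [y ->]] <-]; rewrite setTI; apply: sub_sigma_algebra.
have /continuousP := @coord_continuous R 1 m ord0 i.
by apply; exact: interval_open.
Qed.

Definition path_increment (s t : TT) (w : wiener) : borel_rV R m :=
  coordinate t w - coordinate s w.

Lemma measurable_path_increment (s t : TT) :
  measurable_fun setT (path_increment s t).
Proof.
apply: (@measurability _ _ wiener (borel_rV R m) setT (path_increment s t)
  (@open 'rV[R]_m)) => //.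
move=> _ [U oU <-]; rewrite setTI; apply: sub_sigma_algebra.
have : continuous (path_increment s t : paths R T m -> 'rV[R]_m).
  move=> w; apply: (@continuousB _ _ _ (fun w : paths R T m => path_fun w t)
    (fun w : paths R T m => path_fun w s)); exact: path_eval_continuous.
by move=> /continuousP; apply.
Qed.

Definition coordinate_cylinders (s : seq TT) : set (set wiener) :=
  [set A | exists t i (B : set R), [/\ t \in s, measurable B &
    A = [set w | B (coordinate t w ord0 i)]]].

(** Allowing a whole sigma-algebra for each finite list of times makes closure under complement
    immediate; for intersections the two lists are concatenated. *)
Definition cylinder_algebra : set (set wiener) :=
  [set A | exists s, <<s coordinate_cylinders s >> A].

Lemma coordinate_cylinders_subset s s' : {subset s <= s'} ->
  <<s coordinate_cylinders s >> `<=` <<s coordinate_cylinders s' >>.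
Proof.
move=> ss'; apply: sub_sigma_algebra2 => _ [t [i [B [ts mB ->]]]].
by exists t, i, B; split => //; exact: ss'.
Qed.

Lemma cylinder_algebraT : cylinder_algebra setT.
Proof.
exists [::].
exact: (@measurableT _ (g_sigma_algebraType (coordinate_cylinders [::]))).
Qed.

Lemma cylinder_algebraC : setC_closed cylinder_algebra.
Proof.
move=> A [s sA]; exists s.
exact: (@measurableC _ (g_sigma_algebraType (coordinate_cylinders s))).
Qed.

Lemma cylinder_algebraI : setI_closed cylinder_algebra.
Proof.
move=> A B [s sA] [s' sB]; exists (s ++ s').
apply: (@measurableI _ (g_sigma_algebraType (coordinate_cylinders (s ++ s')))).
  by apply: coordinate_cylinders_subset sA => t ts; rewrite mem_cat ts.
by apply: coordinate_cylinders_subset sB => t ts; rewrite mem_cat ts orbT.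
Qed.

Lemma cylinder_algebra_measurable : cylinder_algebra `<=` measurable.
Proof.
move=> A [s]; apply: smallest_sub; first exact: sigma_algebra_measurable.
move=> _ [t [i [B [_ mB ->]]]].
(* Paths vanish at time 0, so a coordinate is an increment from time 0. *)
have m1 := measurable_path_increment (time0 R T) t.
have := measurableT_comp (measurable_entry i) m1 measurableT mB.
rewrite setTI; congr (measurable _); apply/seteqP; split => w;
  by rewrite /= /path_increment /coordinate path_time0 subr0.
Qed.

Lemma measurable_cylinder_algebra : measurable `<=` <<s cylinder_algebra >>.
Proof.
apply: smallest_sub; first exact: smallest_sigma_algebra.
pose M := g_sigma_algebraType cylinder_algebra.
move=> U /open_paths_fits ->.
rewrite bigcup_mkcond.
apply: (@countable_bigcupT_measurable _ M); first exact: countableP.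
move=> cs; case: ifPn => // _.
rewrite (_ : fits cs = \bigcap_c \bigcap_q \bigcap_i
    [set w | c \in cs -> cell_window c (rat_time R T q) ->
      `|rat_real R (c.1.2 ord0 i) - path_fun w (rat_time R T q) ord0 i|
       <= rat_real R c.2]); last first.
  by apply/seteqP; split => [w h c _ q _ i _ cc cq|w h c cc q cq i];
    [exact: h|exact: h].
apply: (@countable_bigcapT_measurable _ M) => c.
apply: (@countable_bigcapT_measurable _ M) => q.
apply: (@countable_bigcapT_measurable _ M) => i.
apply: (@measurable_implies _ M); apply: (@measurable_implies _ M).
apply: sub_sigma_algebra; exists [:: rat_time R T q]; apply: sub_sigma_algebra.
exists (rat_time R T q), i,
  [set x | `|rat_real R (c.1.2 ord0 i) - x| <= rat_real R c.2].
split => //; first exact: mem_head.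
have -> : [set x | `|rat_real R (c.1.2 ord0 i) - x| <= rat_real R c.2] =
    `[rat_real R (c.1.2 ord0 i) - rat_real R c.2,
      rat_real R (c.1.2 ord0 i) + rat_real R c.2]%classic; last first.
  exact: measurable_itv.
by apply/seteqP; split => x /=; rewrite in_itv /= ler_distlC.
Qed.

End Cylinders.

Lemma exists_monotone_enumeration (R : realType) (T : time_axis)
    (s : seq (time R T)) :
  exists (t : nat -> time R T) (n : nat),
    (forall i, \val (t i) <= \val (t i.+1)) /\
    forall x, x \in s -> exists2 k, (k <= n)%N & t k = x.
Proof.
pose r (x y : time R T) := \val x <= \val y.
have rtr : transitive r by move=> x y z; exact: le_trans.
have rr : reflexive r by move=> x; exact: lexx.
pose ss := sort r (time0 R T :: s).
have ss0 : (0 < size ss)%N by rewrite size_sort.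
have sss : sorted r ss by apply: sort_sorted => x y; exact: le_total.
(* Clamping the index repeats the largest time forever, so that [t] is monotone on all of [nat]; the
   prepended time 0 keeps [ss] nonempty. *)
pose t k := nth (time0 R T) ss (minn k (size ss).-1).
have lt_ss k : (minn k (size ss).-1 < size ss)%N.
  by rewrite gtn_min prednK// leqnn orbT.
exists t, (size ss); split.
  move=> i; apply: (sorted_leq_nth rtr rr) => //; rewrite ?inE//=.
  by rewrite leq_min geq_minr andbT (leq_trans (geq_minl _ _)).
move=> x xs; have xss : x \in ss by rewrite mem_sort inE xs orbT.
exists (index x ss); first exact: index_size.
rewrite /t (minn_idPl _) ?nth_index//.
by rewrite -ltnS prednK// index_mem.
Qed.

(** * Increments along a monotone sequence of times, and the shift *)

Section Increments.
Context (R : realType) (T : time_axis) (m : nat).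
Local Notation TT := (time R T).
Local Notation wiener := (wiener_space R T m).
Implicit Types (t : nat -> TT) (B : nat -> set (borel_rV R m)).

Definition increment_rect t n B : set wiener :=
  [set w | forall i, (i < n)%N -> B i (path_increment (t i) (t i.+1) w)].

Definition increment_rects t n : set (set wiener) :=
  [set A | exists2 B, (forall i, measurable (B i)) & A = increment_rect t n B].

Lemma increment_rectsT t n : increment_rects t n setT.
Proof. by exists (fun=> setT) => //; apply/seteqP; split. Qed.

Lemma increment_rectsI t n : setI_closed (increment_rects t n).
Proof.
move=> _ _ [B mB ->] [B' mB' ->]; exists (fun i => B i `&` B' i).
  by move=> i; exact: measurableI.
apply/seteqP; split => [w [h h'] i ni|w h].
  by split; [exact: h|exact: h'].
by split => i /h[].
Qed.

Lemma increment_rects_measurable t n : increment_rects t n `<=` measurable.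
Proof.
move=> _ [B mB ->].
rewrite (_ : increment_rect t n B = \bigcap_i
    [set w | (i < n)%N -> B i (path_increment (t i) (t i.+1) w)]); last first.
  by apply/seteqP; split => [w h i _|w h i]; [exact: h|exact: h].
apply: countable_bigcapT_measurable => i; apply: measurable_implies.
by rewrite -[X in measurable X]setTI; exact: measurable_path_increment.
Qed.

(** The increments from [t 0] to [t k] are sums of consecutive ones, and a coordinate is the
    difference of two such sums, ending at its time and at time 0. Time 0 must be enumerated because
    [t 0] may be negative on the full line. *)
Lemma coordinate_cylinders_increment_rects (s : seq TT) t n :
  (forall x, x \in time0 R T :: s -> exists2 k, (k <= n)%N & t k = x) ->
  <<s coordinate_cylinders (m := m) s >> `<=` <<s increment_rects t n >>.
Proof.
move=> hs; apply: smallest_sub; first exact: smallest_sigma_algebra.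
move=> _ [x [i [B [xs mB ->]]]].
pose M := g_sigma_algebraType (increment_rects t n).
have mincr k : (k < n)%N ->
    measurable_fun setT (fun w : M => path_increment (t k) (t k.+1) w ord0 i).
  move=> kn _ C mC; rewrite setTI; apply: sub_sigma_algebra.
  exists (fun j =>
    if j == k then [set v : borel_rV R m | C (v ord0 i)] else setT).
    move=> j; case: ifP => // _.
    by rewrite -[X in measurable X]setTI; exact: measurable_entry.
  apply/seteqP; split => [w h j jn|w /(_ k kn)/=]; last by rewrite eqxx.
  by case: eqP => // ->.
have mfrom0 k : (k <= n)%N ->
    measurable_fun setT
      (fun w : M => (path_increment (t 0) (t k) w ord0 i : R)).
  elim: k => [_|k IHk kn].
    rewrite (_ : (fun w => _) = cst 0); first exact: measurable_cst.
    by apply/funext => w; rewrite /path_increment subrr mxE.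
  rewrite (_ : (fun w => _) = (fun w : M => path_increment (t 0) (t k) w ord0 i)
    \+ (fun w => path_increment (t k) (t k.+1) w ord0 i)).
    by apply: measurable_funD; [exact: IHk (ltnW kn)|exact: mincr].
  by apply/funext => w; rewrite /path_increment /= !mxE; lra.
have [k kn tk] := hs x (mem_behead (s := _ :: s) xs).
have [l ln tl] := hs _ (mem_head _ _).
have xE w : path_increment (t 0) (t k) w ord0 i -
    path_increment (t 0) (t l) w ord0 i = coordinate x w ord0 i.
  by rewrite /path_increment tk tl !mxE /coordinate path_time0 mxE; lra.
have := measurable_funB (mfrom0 k kn) (mfrom0 l ln) measurableT mB.
by rewrite setTI; congr (<<s _ >> _); apply/seteqP; split => w /=; rewrite xE.
Qed.

Lemma path_increment_shift (h s t : TT) (w : wiener) :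
  path_increment s t (brownian_shift h w) =
  path_increment (timeD h s) (timeD h t) w.
Proof.
by rewrite /path_increment /coordinate /path_fun /= /brownian_shift_fun
  opprB addrA subrK.
Qed.

(** Conditions on a single coordinate generate the sigma-algebra, and the coordinate at [t] of the
    shifted path is the increment from [h] to [timeD h t]. *)
Lemma measurable_shift (h : TT) :
  measurable_fun setT (brownian_shift h : wiener -> wiener).
Proof.
pose G : set (set wiener) := [set A | exists s, coordinate_cylinders s A].
have sG : @measurable _ wiener = <<s G >>.
  apply/seteqP; split; last first.
    apply: smallest_sub; first exact: sigma_algebra_measurable.
    move=> A [s sA]; apply: cylinder_algebra_measurable; exists s.
    exact: sub_sigma_algebra.
  apply: (subset_trans (@measurable_cylinder_algebra R T m)).
  apply: smallest_sub; first exact: smallest_sigma_algebra.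
  move=> A [s]; apply: sub_sigma_algebra2 => {}A sA; by exists s.
apply: (@measurability _ _ wiener wiener setT (brownian_shift h) G sG).
move=> _ [_ [s [t [i [B [_ mB ->]]]]] <-].
exact: (measurableT_comp (measurable_entry i)
  (measurable_path_increment h (timeD h t)) measurableT mB).
Qed.

Lemma shift_increment_rect (h : TT) t n B :
  brownian_shift h @^-1` increment_rect t n B =
  increment_rect (fun i => timeD h (t i)) n B.
Proof.
by apply/seteqP; split => w hw i ni; have := hw i ni;
  rewrite path_increment_shift.
Qed.

Lemma shift_timeD (h h' : TT) (w : wiener) :
  brownian_shift h' (brownian_shift h w) = brownian_shift (timeD h h') w.
Proof.
apply/val_inj/funext => s; rewrite /= /brownian_shift_fun /path_fun /=.
rewrite /brownian_shift_fun opprB addrA subrK.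
by congr (path_fun w _ - _); apply/val_inj; rewrite /= addrA.
Qed.

End Increments.

(** * Wiener measure *)

Section Wiener.
Context (R : realType) (T : time_axis) (m : nat).
Local Notation TT := (time R T).
Local Notation wiener := (wiener_space R T m).
Variable P : probability wiener R.
Hypothesis hP : wiener_measure P.
Implicit Types (t : nat -> TT) (B : nat -> set (borel_rV R m)).

Lemma wiener_increment_rect t n B : (forall i, \val (t i) <= \val (t i.+1)) ->
  (forall i, measurable (B i)) ->
  P (increment_rect t n B) =
  (\prod_(0 <= i < n) P (path_increment (t i) (t i.+1) @^-1` B i))%E.
Proof.
move=> tmono mB; have /(_ _ _ tmono) := bm_independent hP.
move=> /(_ n (fun i : 'I_n => B i) (fun i => mB i)); rewrite big_mkord => <-.
congr (P _); apply/seteqP; split => [w h i|w h i ni]; first exact: h.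
exact: (h (Ordinal ni)).
Qed.

Lemma wiener_increment_shift (h s t : TT) (B : set (borel_rV R m)) :
  measurable B ->
  P (path_increment (timeD h s) (timeD h t) @^-1` B) =
  P (path_increment s t @^-1` B).
Proof. exact: (bm_stationary hP). Qed.

Lemma shift_increment_rect_prob (h : TT) t n B :
  (forall i, \val (t i) <= \val (t i.+1)) -> (forall i, measurable (B i)) ->
  P (brownian_shift h @^-1` increment_rect t n B) = P (increment_rect t n B).
Proof.
move=> tmono mB; rewrite shift_increment_rect !wiener_increment_rect//.
  by apply: eq_bigr => i _; exact: wiener_increment_shift.
by move=> i; rewrite /= lerD2l; exact: tmono.
Qed.

(** On increment rectangles this is independence with stationarity. Uniqueness on a pi-system is
    used twice: from rectangles to the events of finitely many times, then from the cylinder algebra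
    to all events. *)
Lemma brownian_shift_preserving (h : TT) :
  measure_preserving P (brownian_shift h).
Proof.
split; first exact: measurable_shift.
move=> A mA; apply: (@eq_probability_sigma _ _ _ _ _ (@cylinder_algebra R T m)).
- exact: measurable_shift.
- exact: cylinder_algebraI.
- exact: cylinder_algebraT.
- exact: cylinder_algebra_measurable.
- move=> {mA}A [s sA].
  have [t [n [tmono hs]]] := exists_monotone_enumeration (time0 R T :: s).
  apply: (@eq_probability_sigma _ _ _ _ _ (@increment_rects R T m t n)).
  + exact: measurable_shift.
  + exact: increment_rectsI.
  + exact: increment_rectsT.
  + exact: increment_rects_measurable.
  + by move=> _ [B mB ->]; exact: shift_increment_rect_prob.
  + exact: coordinate_cylinders_increment_rects sA.
- exact: measurable_cylinder_algebra.
Qed.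

(** The shift is long enough for the times [t 0], ..., [t n] followed by their translates by [h] to
    be monotone, so the intersection is a single increment rectangle. *)
Lemma increment_rect_shift_independent (h : TT) t n B B' :
  (forall i, \val (t i) <= \val (t i.+1)) ->
  \val (t n) <= \val h + \val (t 0) ->
  (forall i, measurable (B i)) -> (forall i, measurable (B' i)) ->
  P (increment_rect t n B `&` brownian_shift h @^-1` increment_rect t n B') =
  (P (increment_rect t n B) *
   P (brownian_shift h @^-1` increment_rect t n B'))%E.
Proof.
move=> tmono tnh mB mB'.
(* The original times fill the indices up to [n], the translates start at [n.+1]. Index [n] carries
   the bridging increment from [t n] to [timeD h (t 0)], which [D] leaves unconstrained. *)
pose u k := if (k <= n)%N then t k else timeD h (t (k - n.+1)%N).
pose D i := if (i < n)%N then B i else if i == n then setT else B' (i - n.+1)%N.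
have uE1 i : (i <= n)%N -> u i = t i by rewrite /u => ->.
have uE2 i : u (i + n.+1)%N = timeD h (t i).
  by rewrite /u leqNgt addnS ltnS leq_addl /= subSS addnK.
have DE1 i : (i < n)%N -> D i = B i by rewrite /D => ->.
have DE2 i : D (i + n.+1)%N = B' i.
  rewrite /D ltnNge (leq_trans (leqnSn n)) ?leq_addl//= addnS subSS addnK.
  by rewrite gtn_eqF// ltnS leq_addl.
have umono i : \val (u i) <= \val (u i.+1).
  have [ilt|igt|->] := ltngtP i n.
  - by rewrite !uE1// ltnW.
  - rewrite -(subnK igt) -addSn !uE2 /= lerD2l; exact: tmono.
  - by rewrite uE1// -[n.+1]add0n uE2.
have mD i : measurable (D i).
  by rewrite /D; case: ifP => // _; case: ifP.
have -> : increment_rect t n B `&`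
      brownian_shift h @^-1` increment_rect t n B' =
    increment_rect u (n + n.+1) D.
  rewrite shift_increment_rect; apply/seteqP; split => [w [h1 h2] i ilt|w hw].
    have [iln|igt|->] := ltngtP i n.
    - by rewrite DE1// !uE1// ?(ltnW iln)//; exact: h1.
    - rewrite -(subnK igt) -addSn !uE2 DE2; apply: h2.
      by rewrite ltn_subLR// addnC.
    - by rewrite /D ltnn eqxx.
  split => i ilt.
    have := hw i (leq_trans ilt (leq_addr _ _)).
    by rewrite DE1// !uE1// ltnW.
  have := hw (i + n.+1)%N; rewrite ltn_add2r => /(_ ilt).
  by rewrite -addSn !uE2 DE2.
rewrite shift_increment_rect !wiener_increment_rect//; last first.
  by move=> i; rewrite /= lerD2l; exact: tmono.
rewrite (@big_cat_nat _ _ _ n)//= ?leq_addr//; congr (_ * _)%E.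
  apply: eq_big_nat => i /andP[_ ilt].
  by rewrite DE1// !uE1// ltnW.
(* The bridging factor equals 1; the remaining factors are reindexed by [n.+1]. *)
rewrite big_ltn ?addnS ?ltnS ?leq_addl// /D ltnn eqxx preimage_setT.
rewrite probability_setT mul1e -addSn -{1}[n.+1]add0n big_addn addnC addnK.
by apply: eq_big_nat => i /andP[_ ilt]; rewrite -addSn !uE2 -/(D _) DE2.
Qed.

(** Rectangles are replaced by general events one factor at a time: [A] is reduced to a rectangle
    with [A'] fixed (taking [id] as the map), then [A'] with that rectangle fixed. *)
Lemma increments_shift_independent (h : TT) t n A A' :
  (forall i, \val (t i) <= \val (t i.+1)) ->
  \val (t n) <= \val h + \val (t 0) ->
  <<s increment_rects t n >> A -> <<s increment_rects t n >> A' ->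
  P (A `&` brownian_shift h @^-1` A') = (P A * P (brownian_shift h @^-1` A'))%E.
Proof.
move=> tmono tnh sA sA'.
have [rI rT rm] := And3 (@increment_rectsI R T m t n)
  (@increment_rectsT R T m t n) (@increment_rects_measurable R T m t n).
have mA' : measurable (brownian_shift h @^-1` A').
  apply: measurable_preimage; first exact: measurable_shift.
  by apply: (smallest_sub _ rm) sA'; exact: sigma_algebra_measurable.
rewrite setIC muleC.
apply: (@independent_sigma _ _ _ P id _ (increment_rects t n)) sA => //.
move=> _ [B mB ->]; rewrite preimage_id setIC muleC.
apply: (@independent_sigma _ _ _ P _ _ (increment_rects t n)) sA' => //.
- exact: measurable_shift.
- by apply: rm; exists B.
- by move=> _ [B' mB' ->]; exact: increment_rect_shift_independent.
Qed.

Lemma brownian_shift_zero_one (tau : TT) (A : set wiener) : 0 < \val tau ->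
  measurable A -> brownian_shift tau @^-1` A = A -> P A = 0%E \/ P A = 1%E.
Proof.
move=> tau0 mA tauA.
pose h n := iter n (timeD tau) (time0 R T).
have hE n : \val (h n) = \val tau *+ n.
  by elim: n => [//|n IHn]; rewrite mulrS -IHn.
apply: (@zero_one_of_asymptotic_independence _ _ _ _
  (fun n => brownian_shift (h n)) (@cylinder_algebra R T m)) => //.
- by move=> n; exact: brownian_shift_preserving.
- exact: cylinder_algebraT.
- exact: cylinder_algebraI.
- exact: cylinder_algebraC.
- exact: cylinder_algebra_measurable.
- exact: measurable_cylinder_algebra.
- move=> B [s sB].
  have [t [n [tmono hs]]] := exists_monotone_enumeration (time0 R T :: s).
  have sB' := coordinate_cylinders_increment_rects hs sB.
  (* By the Archimedean property some multiple of [tau] exceeds the span of the times on which [B]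
     depends. *)
  have [k] : exists k, \val (t n) - \val (t 0) <= \val tau *+ k.
    exists (Num.bound `|(\val (t n) - \val (t 0)) / \val tau|).
    rewrite -mulr_natr -ler_pdivrMl// mulrC ltW//.
    by rewrite (le_lt_trans (ler_norm _))// archi_boundP.
  rewrite lerBlDr -hE => hk.
  by exists k; exact: (increments_shift_independent tmono hk sB' sB').
(* Invariance under [tau] passes to its multiples; the shift by time 0 is the identity because paths
   start at 0. *)
- elim => [|n IHn].
    rewrite (_ : brownian_shift (h 0) = id)//; apply/funext => w.
    apply/val_inj/funext => s.
    rewrite /= /brownian_shift_fun path_time0 subr0.
    by congr (path_fun w _); apply/val_inj; rewrite /= add0r.
  rewrite -[RHS]tauA -[in RHS]IHn; apply/seteqP; split => w /=;
    by rewrite shift_timeD.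
Qed.

End Wiener.

Theorem theorem2p8 (R : realType) (T : time_axis) (m : nat) (hm : (0 < m)%N)
    (P : probability (wiener_space R T m) R) (hP : wiener_measure P)
    (tau : time R T) (htau : 0 < \val tau) :
  ergodic_family P (@brownian_shift R T m) /\ ergodic_map P (brownian_shift tau).
Proof.
split; split.
- exact: brownian_shift_preserving.
- move=> A mA invA.
  (* A set invariant under all shifts is in particular invariant under the shift by [tau]. *)
  exact: (brownian_shift_zero_one hP htau mA (invA tau)).
- exact: brownian_shift_preserving.
- by move=> A mA invA; exact: (brownian_shift_zero_one hP htau mA invA).
Qed.
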